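(* Let $G$ be a graph on $n$ vertices with no isolated vertices, and let $k$ be an integer with $1\le k \leq \left\lfloor \frac{n}{2}\right\rfloor$. Then $$\alpha(T_k(G)) \leq \frac{1}{k}\binom{n}{k-1}\alpha(G).$$ Moreover, if equality occurs, then there exists a $t$-$(n,k,\lambda)$ design with $t=k-1$ and $\lambda=\alpha(G)$.
   Context: All graphs are finite and simple. For a graph $G$ with vertex set $V$ of size $n$ and $1\le k\le n-1$, the $k$-token graph $T_k(G)$ has as vertices the $k$-subsets of $V$, two of them adjacent if their symmetric difference is an edge of $G$. $\alpha(\Gamma)$ denotes the independence number of a graph $\Gamma$ (maximum size of a set of pairwise non-adjacent vertices). A $t$-$(v,k,\lambda)$ design is a collection of $k$-subsets of a $v$-element set such that every $t$-subset is contained in exactly $\lambda$ of these $k$-subsets. *)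

(* Defs.v *)
From mathcomp Require Export all_boot all_order all_algebra.

Set Implicit Arguments.
Unset Strict Implicit.
Unset Printing Implicit Defensive.

Record sgraph := SGraph {
  vertex :> finType;
  adj : rel vertex;
  adj_sym : symmetric adj;
  adj_irrefl : irreflexive adj
}.

Definition no_isolated (G : sgraph) : Prop :=
  forall x : G, exists y : G, adj x y.

Definition independent (G : sgraph) (S : {set G}) : bool :=
  [forall x in S, forall y in S, ~~ adj x y].

Definition alpha (G : sgraph) : nat :=
  \max_(S : {set G} | independent S) #|S|.

Definition symdiff (T : finType) (A B : {set T}) : {set T} :=
  (A :\: B) :|: (B :\: A).

Definition is_edge (G : sgraph) (E : {set G}) : bool :=
  [exists x, exists y, adj x y && (E == [set x; y])].

Section TokenGraph.
Variables (G : sgraph) (k : nat).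

Definition ksubset : finType := {A : {set G} | #|A| == k}.

Definition token_adj : rel ksubset :=
  [rel A B | is_edge (symdiff (val A) (val B))].

Lemma token_adj_sym : symmetric token_adj.
Proof. by move=> A B; rewrite /token_adj /= /symdiff setUC. Qed.

Lemma token_adj_irrefl : irreflexive token_adj.
Proof.
move=> A; rewrite /token_adj /= /symdiff setDv setU0.
apply/negbTE/negP => /existsP[x /existsP[y /andP[_ /eqP E]]].
by have := set21 x y; rewrite -E inE.
Qed.

Definition token_graph : sgraph := SGraph token_adj_sym token_adj_irrefl.

End TokenGraph.

Definition is_design (t v k lambda : nat) (X : finType)
    (B : {set {set X}}) : Prop :=
  [/\ #|X| = v,
      forall b : {set X}, b \in B -> #|b| = k
    & forall S : {set X}, #|S| = t ->
        #|[set b in B | S \subset b]| = lambda].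

(* Main.v *)
Require Import Defs.
From mathcomp Require Import all_boot all_order all_algebra.
Import Order.TTheory GRing.Theory Num.Theory.
Local Open Scope ring_scope.

(** For an independent set [S] of the token graph and a (k-1)-subset [A], the
    vertices completing [A] to a member of [S] form an independent set of [G].
    Hence [A] lies in at most alpha(G) members of [S], and counting the pairs
    [A \subset b] with [b] in [S] in two ways bounds k |S|. Equality forces
    equality for every [A], so a maximum [S] is itself the design. *)

Lemma independentP (G : sgraph) (S : {set G}) :
  reflect {in S &, forall x y, ~~ adj x y} (independent S).
Proof.
apply: (iffP 'forall_in_forall_inP) => [H x y xS yS|H x xS y yS]; exact: H.
Qed.

Lemma leq_card_alpha (G : sgraph) (S : {set G}) :
  independent S -> (#|S| <= alpha G)%N.
Proof. by move=> indS; apply: (@leq_bigmax_cond _ _ (fun S : {set G} => #|S|)). Qed.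

Lemma alpha_attained (G : sgraph) :
  exists2 S : {set G}, independent S & #|S| = alpha G.
Proof.
have ind0 : independent (set0 : {set G}).
  by apply/independentP => x y; rewrite inE.
rewrite /alpha.
have [|S indS ->] := @eq_bigmax_cond _ (@independent G) (fun S => #|S|).
  (* A maximum over a nonempty family is attained; the empty set witnesses that independent sets
     exist. *)
  by apply/card_gt0P; exists set0.
by exists S.
Qed.

Lemma symdiff_setU1 (T : finType) (A : {set T}) (x y : T) :
  x \notin A -> y \notin A -> x != y ->
  symdiff (x |: A) (y |: A) = [set x; y].
Proof.
move=> xA yA neq_xy; apply/setP=> z; rewrite !inE.
have [->|zx] := eqVneq z x; first by rewrite (negPf neq_xy) (negPf xA).
have [->|zy] := eqVneq z y; first by rewrite (negPf yA).
by case: (z \in A).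
Qed.

Lemma subset_card_setU1 (T : finType) (A b : {set T}) :
  A \subset b -> #|b| = #|A|.+1 -> exists2 x, x \notin A & b = x |: A.
Proof.
move=> sAb cb; have /cards1P[x bAx] : #|b :\: A| == 1%N.
  by rewrite cardsD (setIidPr sAb) cb subSnn.
exists x; first by have := set11 x; rewrite -bAx inE => /andP[].
by rewrite -bAx setUC setDE setUIr setUCr setIT; apply/esym/setUidPr.
Qed.

(** Double counting of the pairs [A \subset b]: exchanging the sums, each block [b] contributes its
    ['C(k, t)] subsets of size [t]. *)
Lemma sum_card_subsets (T : finType) (B : {set {set T}}) (k t : nat) :
  {in B, forall b : {set T}, #|b| = k} ->
  (\sum_(A : {set T} | #|A| == t) #|[set b in B | A \subset b]|
    = #|B| * 'C(k, t))%N.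
Proof.
move=> cB.
under eq_bigr => A _ do
  [rewrite -sum1_card (eq_bigl (fun b => (b \in B) && (A \subset b)));
   [|by move=> b; rewrite inE]].
rewrite (exchange_big_dep (mem B)) /=; last by move=> A b _ /andP[].
rewrite -sum_nat_const; apply: eq_bigr => b bB.
rewrite sum1dep_card -[in RHS](cB b bB) -cards_draws.
by apply: eq_card => A; rewrite !inE bB andbC.
Qed.

Section IndependentTokenSet.
Variables (G : sgraph) (k : nat) (S : {set token_graph G k.+1}).
Hypothesis indS : independent S.
(** Forgetting the size proofs carried by members of [S] lets them be compared by inclusion with
    sets of any size. *)
Let B : {set {set G}} := [set val b | b in S].

Lemma card_block : {in B, forall b : {set G}, #|b| = k.+1}.
Proof. by move=> _ /imsetP[b _ ->]; apply/eqP/(valP b). Qed.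

Lemma card_blocks : #|B| = #|S|.
Proof. exact/card_imset/val_inj. Qed.

(** If two completions [x], [y] were adjacent, the blocks [x |: A] and [y |: A] would differ exactly
    by the edge [[set x; y]], hence be adjacent members of [S]. *)
Lemma independent_completions (A : {set G}) :
  independent [set x : G | (x \notin A) && (x |: A \in B)].
Proof.
apply/independentP => x y; rewrite !inE.
move=> /andP[xA /imsetP[a aS xAa]] /andP[yA /imsetP[b bS yAb]].
have [->|neq_xy] := eqVneq x y; first by rewrite adj_irrefl.
apply/negP => adj_xy; have /negP[] := independentP _ _ indS a b aS bS.
rewrite /= /token_adj /= -xAa -yAb symdiff_setU1 //.
by apply/existsP; exists x; apply/existsP; exists y; rewrite adj_xy eqxx.
Qed.

Lemma card_blocks_over (A : {set G}) :
  #|A| = k -> (#|[set b in B | A \subset b]| <= alpha G)%N.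
Proof.
move=> cA; apply: leq_trans (leq_card_alpha _ _ (independent_completions A)).
(* A block over [A] has one extra vertex, so these blocks lie in the image of the completions under
   [x |: A]. *)
apply: leq_trans (leq_imset_card (fun x => x |: A) _).
apply/subset_leq_card/subsetP => b; rewrite inE => /andP[bB sAb].
have [|x xA bE] := subset_card_setU1 _ _ _ sAb; first by rewrite cA card_block.
by apply/imsetP; exists x; rewrite // inE xA -bE.
Qed.

(** The local bounds are summed over all [A] of size [k]. The [leqif] form also records that the
    sums agree only if every term is tight. *)
Lemma independent_token_leqif :
  (k.+1 * #|S| <= 'C(#|G|, k) * alpha G
     ?= iff [forall (A : {set G} | #|A| == k),
              #|[set b in B | A \subset b]| == alpha G])%N.
Proof.
have <- : (\sum_(A : {set G} | #|A| == k) #|[set b in B | A \subset b]|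
            = k.+1 * #|S|)%N.
  (* The factor [k.+1] is ['C(k.+1, k)]. *)
  by rewrite (sum_card_subsets _ _ _ _ card_block) card_blocks binSn mulnC.
have <- : (\sum_(A : {set G} | #|A| == k) alpha G = 'C(#|G|, k) * alpha G)%N.
  by rewrite sum_nat_cond_const -card_draws; congr (_ * _)%N;
     apply: eq_card => A; rewrite !inE.
by apply: leqif_sum => A /eqP cA; split=> //; apply: card_blocks_over.
Qed.

End IndependentTokenSet.

Theorem theorem2p1 (G : sgraph) (n k : nat)
    (hn : #|G| = n) (hG : no_isolated G) (hk1 : (1 <= k)%N) (hk : (k <= n %/ 2)%N) :
  ((alpha (token_graph G k))%:R
     <= (1 / k%:R) * ('C(n, k - 1))%:R * (alpha G)%:R :> rat)
  /\
  ((alpha (token_graph G k))%:R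
     = (1 / k%:R) * ('C(n, k - 1))%:R * (alpha G)%:R :> rat ->
   exists (X : finType) (B : {set {set X}}),
     is_design (k - 1) n k (alpha G) B).
Proof.
case: k hk1 hk => // k _ _; rewrite subSS subn0.
have k_gt0 : 0 < k.+1%:R :> rat by rewrite ltr0n.
have [S indS cS] := alpha_attained (token_graph G k.+1).
have := independent_token_leqif _ _ _ indS; rewrite cS hn => bound.
rewrite mul1r -mulrA mulrC; split.
  by rewrite ler_pdivlMr // -!natrM ler_nat mulnC bound.
(* Clearing the denominator returns to natural numbers, where the equality case of [bound]
   applies. *)
move/(congr1 ( *%R^~ k.+1%:R)); rewrite divfK ?gt_eqF // -!natrM => /eqP.
rewrite eqr_nat mulnC bound => /forall_inP tight.
exists G, [set val b | b in S]; split=> //; first exact: card_block.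
by move=> A /eqP cA; apply/eqP/tight.
Qed.
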